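(* Suppose that the reference element $\hat K$ is taken as a simplex with non-obtuse dihedral angles. If the simplicial mesh $\mathcal{T}_h$ of $\Omega$ satisfies $$(F_K')^{-1}\,\mathbb{D}_K\,(F_K')^{-T}=C_K I,\qquad\forall K\in\mathcal{T}_h,$$ where $C_K$ is a positive constant on $K$ and $I$ is the $d\times d$ identity matrix, then the linear finite element scheme for the boundary value problem $-\nabla\cdot(\mathbb{D}\nabla u)=f$ in $\Omega$, $u=g$ on $\partial\Omega$ (as defined in the context, with quadrature) satisfies the discrete maximum principle (DMP).
   Context: Problem. $d\in\{1,2,3\}$; $\Omega\subset\mathbb{R}^d$ is a connected (bounded) interval, polygon or polyhedron; $f$ and $g$ are given functions; $\mathbb{D}=\mathbb{D}(\boldsymbol{x})$ is a $d\times d$ diffusion matrix, symmetric and strictly positive definite on $\Omega$. The boundary value problem is $-\nabla\cdot(\mathbb{D}\nabla u)=f$ in $\Omega$, $u=g$ on $\partial\Omega$. Mesh. $\mathcal{T}_h$ is a simplicial triangulation of $\Omega$ with $N_v$ vertices $\boldsymbol{a}_1,\dots,\boldsymbol{a}_{N_v}$, ordered so that the first $N_{vi}$ are the interior ones and the remaining ones lie on $\partial\Omega$. $\phi_j$ is the continuous piecewise linear basis function of the vertex $\boldsymbol{a}_j$. $\hat K$ is a fixed reference simplex; for $K\in\mathcal{T}_h$, $F_K$ is the affine map with $K=F_K(\hat K)$ and $F_K'$ is its (constant) Jacobian matrix; $|K|$ is the volume of $K$. Quadrature. A quadrature rule $\int_{\hat K} v\,d\xi\approx|\hat K|\sum_{k=1}^m\hat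 w_k v(\hat b_k)$ on $\hat K$, with weights $\hat w_k$ satisfying $\sum_{k=1}^m\hat w_k=1$ and quadrature nodes $\hat b_k$, is fixed. Put $b_k^K=F_K(\hat b_k)$ and $\mathbb{D}_K=\sum_{k=1}^m\hat w_k\,\mathbb{D}(b_k^K)$. Scheme. Let $U_0^h=\mathrm{span}\{\phi_1,\dots,\phi_{N_{vi}}\}$. The linear finite element scheme is: find $u^h=\sum_{j=1}^{N_v}u_j\phi_j$ with $u_j=g(\boldsymbol{a}_j)$ for $j=N_{vi}+1,\dots,N_v$ such that $$\sum_{K\in\mathcal{T}_h}|K|\,(\nabla v^h|_K)^T\mathbb{D}_K\nabla u^h|_K=\sum_{K\in\mathcal{T}_h}|K|\sum_{k=1}^m\hat w_k f(b_k^K)\,v^h(b_k^K)\qquad\forall v^h\in U_0^h.$$ DMP. The discrete maximum principle is the discrete counterpart of the maximum principle of the continuous problem: whenever $f(\boldsymbol{x})\le0$ for all $\boldsymbol{x}\in\Omega$, the solution of the scheme satisfies $\max_{\boldsymbol{x}\in\Omega\cup\partial\Omega}u^h(\boldsymbol{x})\le\max\{0,\max_{\boldsymbol{s}\in\partial\Omega}u^h(\boldsymbol{s})\}$. Dihedral angles. If $\hat{\boldsymbol{a}}_1,\dots,\hat{\boldsymbol{a}}_{d+1}$ are the vertices of $\hat K$ and $\hat E=[\hat{\boldsymbol{a}}_2-\hat{\boldsymbol{a}}_1,\dots,\hat{\boldsymbol{a}}_{d+1}-\hat{\boldsymbol{a}}_1]$, put $[\hat{\boldsymbol{q}}_2,\dots,\hat{\boldsymbol{q}}_{d+1}]=\hat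 E^{-T}$ and $\hat{\boldsymbol{q}}_1=-\sum_{i=2}^{d+1}\hat{\boldsymbol{q}}_i$; $\hat{\boldsymbol{q}}_i$ is an inward normal to the face opposite to $\hat{\boldsymbol{a}}_i$. The dihedral angle $\alpha_{ij}$ between the faces opposite to $\hat{\boldsymbol{a}}_i$ and $\hat{\boldsymbol{a}}_j$ ($i\ne j$) is the supplement of the angle between the inward normals, i.e. $\cos\alpha_{ij}=-\hat{\boldsymbol{q}}_i\cdot\hat{\boldsymbol{q}}_j/(\|\hat{\boldsymbol{q}}_i\|\,\|\hat{\boldsymbol{q}}_j\|)$; non-obtuse means $\alpha_{ij}\le\pi/2$.
   Formalization: The quadrature weights are additionally assumed nonnegative, and the nodes are taken in the reference simplex; with a negative weight the claim fails (already for d = 1, D = 1, two elements on (0,1)). *)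

(* Defs.v *)
(* Points of R^d are column vectors 'cV[R]_d. *)
From mathcomp Require Import all_boot all_order all_algebra.
From mathcomp Require Import all_classical all_reals all_analysis.

Set Implicit Arguments.
Unset Strict Implicit.
Unset Printing Implicit Defensive.

Import Order.TTheory GRing.Theory Num.Theory.
Import numFieldNormedType.Exports.

Local Open Scope classical_set_scope.
Local Open Scope ring_scope.

(* The library's norm on matrices is the max norm, hence
   the separate Euclidean norm (needed for angles). *)
Definition dot (R : realType) (d : nat) (u v : 'cV[R]_d) : R :=
  (u^T *m v) 0 0.

Definition enorm (R : realType) (d : nat) (u : 'cV[R]_d) : R :=
  Num.sqrt (dot u u).

Definition boundary (R : realType) (d : nat) (A : set 'cV[R]_d)
  : set 'cV[R]_d := closure A `\` interior A.

Definition conv_hull (R : realType) (d : nat) (I : finType) (A : {set I})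
    (p : I -> 'cV[R]_d) : set 'cV[R]_d :=
  [set x | exists l : I -> R,
    [/\ forall i, i \in A -> 0 <= l i, \sum_(i in A) l i = 1
      & x = \sum_(i in A) l i *: p i]].

(* The closed simplex with vertices p 0, ..., p d. *)
Definition simplex (R : realType) (d : nat) (p : 'I_d.+1 -> 'cV[R]_d)
  : set 'cV[R]_d := conv_hull [set: 'I_d.+1]%SET p.

(* [p 1 - p 0, ..., p d - p 0] *)
Definition edge_mx (R : realType) (d : nat) (p : 'I_d.+1 -> 'cV[R]_d)
  : 'M[R]_d := \matrix_(i, j) (p (lift ord0 j) - p ord0) i 0.

Definition nondeg_simplex (R : realType) (d : nat) (p : 'I_d.+1 -> 'cV[R]_d)
  : Prop := edge_mx p \in unitmx.

Definition simplex_vol (R : realType) (d : nat) (p : 'I_d.+1 -> 'cV[R]_d)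
  : R := `|\det (edge_mx p)| / (d`!)%:R.

Definition centroid (R : realType) (d : nat) (p : 'I_d.+1 -> 'cV[R]_d)
  : 'cV[R]_d := (d.+1%:R)^-1 *: \sum_i p i.

Definition qvec (R : realType) (d : nat) (p : 'I_d.+1 -> 'cV[R]_d)
    (i : 'I_d.+1) : 'cV[R]_d :=
  let Q := (invmx (edge_mx p))^T in
  if unlift ord0 i is Some j then col j Q else - \sum_j col j Q.

Definition dihedral_angle (R : realType) (d : nat) (p : 'I_d.+1 -> 'cV[R]_d)
    (i j : 'I_d.+1) : R :=
  acos (- dot (qvec p i) (qvec p j) / (enorm (qvec p i) * enorm (qvec p j))).

Definition nonobtuse (R : realType) (d : nat) (p : 'I_d.+1 -> 'cV[R]_d)
  : Prop := forall i j : 'I_d.+1, i != j -> dihedral_angle p i j <= pi / 2.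

(* An open interval (d = 1), polygon (d = 2) or polyhedron (d = 3).  The
   condition interior (closure Omega) = Omega rules out slits. *)
Record polytopal_domain (R : realType) (d : nat) (Omega : set 'cV[R]_d)
  : Prop := PolytopalDomain {
  domain_nonempty : Omega !=set0;
  domain_open : open Omega;
  domain_connected : connected Omega;
  domain_bounded : bounded_set Omega;
  domain_regular : interior (closure Omega) = Omega;
  domain_polytopal : exists (n : nat) (p : 'I_n -> 'I_d.+1 -> 'cV[R]_d),
    (forall k, nondeg_simplex (p k)) /\
    closure Omega = \bigcup_(k in [set: 'I_n]) simplex (p k)
}.

Definition spd (R : realType) (d : nat) (A : 'M[R]_d) : Prop :=
  A^T = A /\ forall v : 'cV[R]_d, v != 0 -> 0 < dot v (A *m v).

(* loc K lists the indices of the d+1 vertices of the element K; the numbering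
   inside each element is arbitrary. *)
Record mesh (R : realType) (d : nat) := Mesh {
  nv : nat;
  nvi : nat;
  vert : 'I_nv -> 'cV[R]_d;
  elt : finType;
  loc : elt -> 'I_d.+1 -> 'I_nv
}.

Definition evert (R : realType) (d : nat) (M : mesh R d) (K : elt M)
    (i : 'I_d.+1) : 'cV[R]_d := vert (loc K i).

Definition vset (R : realType) (d : nat) (M : mesh R d) (K : elt M)
  : {set 'I_(nv M)} := [set loc K i | i : 'I_d.+1]%SET.

Definition cell (R : realType) (d : nat) (M : mesh R d) (K : elt M)
  : set 'cV[R]_d := simplex (evert K).

(* Together with tri_elt_inj, tri_conforming says that two distinct elements
   meet in a common proper face, possibly empty. *)
Record triangulation (R : realType) (d : nat) (Omega : set 'cV[R]_d)
    (M : mesh R d) : Prop := Triangulation {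
  tri_nvi : (nvi M <= nv M)%N;
  tri_vert_inj : injective (@vert R d M);
  tri_vert_used : forall j : 'I_(nv M), exists K : elt M, j \in vset K;
  tri_nondegenerate : forall K : elt M, nondeg_simplex (evert K);
  tri_elt_inj : injective (@vset R d M);
  tri_conforming : forall K K' : elt M,
    cell K `&` cell K' = conv_hull (vset K :&: vset K')%SET (@vert R d M);
  tri_cover : closure Omega = \bigcup_(K in [set: elt M]) cell K;
  tri_interior : forall j : 'I_(nv M), (j < nvi M)%N -> Omega (vert j);
  tri_boundary : forall j : 'I_(nv M),
    (nvi M <= j)%N -> boundary Omega (vert j)
}.

Definition affine_on (R : realType) (d : nat) (A : set 'cV[R]_d)
    (v : 'cV[R]_d -> R) : Prop :=
  exists (p : 'cV[R]_d) (c : R), forall x, A x -> v x = dot p x + c.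

(* These conditions determine the basis function phi of the vertex j on
   closure Omega; its values elsewhere play no role. *)
Record basis_function (R : realType) (d : nat) (Omega : set 'cV[R]_d)
    (M : mesh R d) (j : 'I_(nv M)) (phi : 'cV[R]_d -> R) : Prop :=
  BasisFunction {
  basis_continuous : {within closure Omega, continuous phi};
  basis_affine : forall K : elt M, affine_on (cell K) phi;
  basis_vert : forall i : 'I_(nv M), phi (vert i) = (i == j)%:R
}.

Record affine_map (R : realType) (d : nat) := AffineMap {
  jac : 'M[R]_d;
  trans : 'cV[R]_d
}.

Definition aff (R : realType) (d : nat) (F : affine_map R d) (xi : 'cV[R]_d)
  : 'cV[R]_d := jac F *m xi + trans F.

(* Nonnegative weights are needed for the discrete maximum principle: with a
   negative weight, f <= 0 need not give a nonpositive discrete load. *)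
Record quadrature_rule (R : realType) (d : nat) (Khat : set 'cV[R]_d)
    (m : nat) (w : 'I_m -> R) (b : 'I_m -> 'cV[R]_d) : Prop :=
  QuadratureRule {
  quad_sum : \sum_k w k = 1;
  quad_nodes : forall k, Khat (b k);
  quad_ge0 : forall k, 0 <= w k
}.

Definition DK (R : realType) (d : nat) (D : 'cV[R]_d -> 'M[R]_d)
    (F : affine_map R d) (m : nat) (w : 'I_m -> R) (b : 'I_m -> 'cV[R]_d)
  : 'M[R]_d := \sum_k w k *: D (aff F (b k)).

Definition grad (R : realType) (d : nat) (v : 'cV[R]_d -> R) (x : 'cV[R]_d)
  : 'cV[R]_d := \col_i ('D_(delta_mx i 0) v x).

(* The constant gradient on K of a function v that is affine on K, read off at
   an interior point of K. *)
Definition grad_on (R : realType) (d : nat) (M : mesh R d) (K : elt M)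
    (v : 'cV[R]_d -> R) : 'cV[R]_d := grad v (centroid (evert K)).

Definition fe_fun (R : realType) (d : nat) (M : mesh R d)
    (phi : 'I_(nv M) -> 'cV[R]_d -> R) (U : 'I_(nv M) -> R) (x : 'cV[R]_d)
  : R := \sum_j U j * phi j x.

Definition U0h (R : realType) (d : nat) (M : mesh R d)
    (phi : 'I_(nv M) -> 'cV[R]_d -> R) : set ('cV[R]_d -> R) :=
  [set v | exists V : 'I_(nv M) -> R,
    v = fun x => \sum_(j : 'I_(nv M) | (j < nvi M)%N) V j * phi j x].

Definition fe_solution (R : realType) (d : nat) (f g : 'cV[R]_d -> R)
    (D : 'cV[R]_d -> 'M[R]_d) (M : mesh R d)
    (phi : 'I_(nv M) -> 'cV[R]_d -> R) (F : elt M -> affine_map R d)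
    (m : nat) (w : 'I_m -> R) (b : 'I_m -> 'cV[R]_d) (U : 'I_(nv M) -> R)
  : Prop :=
  (forall j : 'I_(nv M), (nvi M <= j)%N -> U j = g (vert j)) /\
  forall v, U0h phi v ->
    \sum_(K : elt M) simplex_vol (evert K) *
      dot (grad_on K v) (DK D (F K) w b *m grad_on K (fe_fun phi U))
    = \sum_(K : elt M) simplex_vol (evert K) *
      \sum_k w k * f (aff (F K) (b k)) * v (aff (F K) (b k)).

(* For a solution, fe_fun phi U is continuous on the compact set closure Omega,
   so that both suprema are maxima. *)
Definition satisfies_dmp (R : realType) (d : nat) (Omega : set 'cV[R]_d)
    (f g : 'cV[R]_d -> R) (D : 'cV[R]_d -> 'M[R]_d) (M : mesh R d)
    (phi : 'I_(nv M) -> 'cV[R]_d -> R) (F : elt M -> affine_map R d)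
    (m : nat) (w : 'I_m -> R) (b : 'I_m -> 'cV[R]_d) : Prop :=
  (forall x, Omega x -> f x <= 0) ->
  forall U : 'I_(nv M) -> R, fe_solution f g D phi F w b U ->
    sup (fe_fun phi U @` (Omega `|` boundary Omega))
      <= Num.max 0 (sup (fe_fun phi U @` boundary Omega)).

(* Main.v *)
Require Import Defs.
From mathcomp Require Import all_boot all_order all_algebra.
From mathcomp Require Import all_classical all_reals all_analysis.
From mathcomp Require Import ring lra.

Set Implicit Arguments.
Unset Strict Implicit.
Unset Printing Implicit Defensive.

Import Order.TTheory GRing.Theory Num.Theory.
Import numFieldNormedType.Exports.

Local Open Scope classical_set_scope.
Local Open Scope ring_scope.

(** On an element [K] write [q_i] for the gradients of the barycentric
    coordinates, which sum to 0.  Three facts give the discrete maximum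
    principle.

    Sign of the stiffness entries.  The hypothesis on [F_K] amounts to
    [D_K = C_K J J^T] with [J = F_K'], so that [q_i . D_K q_j] is [C_K] times the
    Euclidean product of the pulled-back gradients [J^T q_i] and [J^T q_j].
    These are nonnegative combinations of the reference normals, and for
    [i <> j] no reference normal occurs in both ([F_K] maps vertices to vertices); as
    non-obtuse angles mean that distinct reference normals have nonpositive
    products, the off-diagonal entries are nonpositive ([stiffness_le0]).

    Truncation.  Let [c] be the right-hand side of the principle and test the
    scheme with the finite element function [v] whose nodal values are the
    positive parts [V_j = (U_j - c)^+].  It vanishes at the boundary vertices,
    hence is admissible.  By the sign of the entries
    [a(v, v) <= a(v, u^h)] ([energy_truncation]), while the load of [v] is
    nonpositive.  Here [f <= 0] is known only inside [Omega], but a quadrature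
    node may lie on the boundary; [v] vanishes there, because the basis function
    of an interior vertex vanishes on the boundary of [Omega]
    ([interior_basis_support]).  So [a(v, v) = 0], and [v] is constant on every
    element.

    Connectedness.  The zero set of [v] is then a union of elements whose
    complement in the closure of [Omega] is also a finite union of elements, so
    [v] is constant on that connected closure ([locally_constant_eq0]).  There
    is a boundary vertex ([exists_boundary_vertex]), so [v = 0], that is
    [U_j <= c] at every vertex, and [u^h <= c] by convexity. *)

(** * The Euclidean inner product *)

Section Dot.
Variables (R : realType) (d : nat).
Implicit Types (u v w : 'cV[R]_d) (A : 'M[R]_d).

Lemma dotE u v : dot u v = \sum_i u i 0 * v i 0.
Proof. by rewrite /dot mxE; apply: eq_bigr => i _; rewrite mxE. Qed.

Lemma dotC u v : dot u v = dot v u.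
Proof. by rewrite !dotE; apply: eq_bigr => i _; rewrite mulrC. Qed.

Lemma dotDr u v w : dot u (v + w) = dot u v + dot u w.
Proof. by rewrite /dot mulmxDr mxE. Qed.

Lemma dotZr a u v : dot u (a *: v) = a * dot u v.
Proof. by rewrite /dot -scalemxAr mxE. Qed.

Lemma dotBr u v w : dot u (v - w) = dot u v - dot u w.
Proof. by rewrite -scaleN1r dotDr dotZr mulN1r. Qed.

Lemma dot_sumr (I : finType) (A : pred I) u (v : I -> 'cV[R]_d) :
  dot u (\sum_(i | A i) v i) = \sum_(i | A i) dot u (v i).
Proof. by rewrite /dot mulmx_sumr summxE. Qed.

Lemma dotZl a u v : dot (a *: u) v = a * dot u v.
Proof. by rewrite !(dotC _ v) dotZr. Qed.

Lemma dotBl u v w : dot (v - w) u = dot v u - dot w u.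
Proof. by rewrite !(dotC _ u) dotBr. Qed.

Lemma dot_suml (I : finType) u (v : I -> 'cV[R]_d) :
  dot (\sum_i v i) u = \sum_i dot (v i) u.
Proof. by rewrite dotC dot_sumr; apply: eq_bigr => i _; rewrite dotC. Qed.

Lemma dot_mulmx u v A : dot u (A *m v) = dot (A^T *m u) v.
Proof. by rewrite /dot trmx_mul trmxK mulmxA. Qed.

Lemma dot_deltar u i : dot u (delta_mx i 0) = u i 0.
Proof.
rewrite dotE (bigD1 i) //= big1 ?addr0 => [|j ji]; rewrite mxE ?eqxx.
  by rewrite mulr1.
by rewrite (negbTE ji) mulr0.
Qed.

Lemma dot_ext u v : (forall w, dot u w = dot v w) -> u = v.
Proof. by move=> uv; apply/colP => i; rewrite -!dot_deltar uv. Qed.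

Lemma dot_ge0 u : 0 <= dot u u.
Proof. by rewrite dotE sumr_ge0 // => i _; rewrite -expr2 sqr_ge0. Qed.

Lemma dot_eq0 u : dot u u = 0 -> u = 0.
Proof.
rewrite dotE => /eqP; rewrite psumr_eq0 => [/allP u0|i _]; last first.
  by rewrite -expr2 sqr_ge0.
apply/colP => i; rewrite mxE; apply/eqP.
by have := u0 i (mem_index_enum _); rewrite mulf_eq0 orbb.
Qed.

(** The angle of two vectors is the arc cosine of a quotient, and [acos] inverts
    [cos] only on [[-1, 1]]; this bound keeps the quotient in that range. *)
Lemma cauchy_schwarz u v : `|dot u v| <= enorm u * enorm v.
Proof.
rewrite /enorm -sqrtrM ?dot_ge0 // -sqrtr_sqr; apply: ler_wsqrtr.
have [v0|v0] := eqVneq (dot v v) 0.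
  by rewrite v0 mulr0 (dot_eq0 v0) dotC -(scale0r 0) dotZl mul0r expr0n.
(* The multiple of u minus its projection on v, with denominators cleared. *)
have := dot_ge0 (dot v v *: u - dot u v *: v).
rewrite dotBl !dotBr !dotZl !dotZr (dotC v u).
have vp : 0 < dot v v by rewrite lt_def v0 dot_ge0.
by nra.
Qed.

End Dot.

(** * Barycentric coordinates of a simplex *)

Section Barycentric.
Variables (R : realType) (d : nat) (p : 'I_d.+1 -> 'cV[R]_d).
Hypothesis hp : nondeg_simplex p.

(** The affine function on the whole space with gradient [qvec p i] and the right
    value at the vertex [p ord0]; on the simplex it is a barycentric
    coordinate, and its sign decides membership. *)
Definition bary (i : 'I_d.+1) (x : 'cV[R]_d) : R :=
  dot (qvec p i) (x - p ord0) + (i == ord0)%:R.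

Lemma qvec_lift j : qvec p (lift ord0 j) = col j (invmx (edge_mx p))^T.
Proof. by rewrite /qvec liftK. Qed.

Lemma qvec0 : qvec p ord0 = - \sum_j qvec p (lift ord0 j).
Proof.
rewrite /qvec unlift_none; congr (- _); apply: eq_bigr => j _.
by rewrite liftK.
Qed.

Lemma sum_qvec : \sum_i qvec p i = 0.
Proof. by rewrite big_ord_recl qvec0 addNr. Qed.

Lemma bary_sum x : \sum_i bary i x = 1.
Proof.
rewrite /bary big_split /= -dot_suml sum_qvec dotC -(scale0r 0) dotZr mul0r.
by rewrite add0r big_ord_recl eqxx big1 ?addr0.
Qed.

Lemma bary_diff i x y : bary i x - bary i y = dot (qvec p i) (x - y).
Proof. by rewrite /bary !dotBr; ring. Qed.

Lemma bary_comb (I : finType) (A : pred I) i (l : I -> R)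
    (x : I -> 'cV[R]_d) : \sum_(k | A k) l k = 1 ->
  bary i (\sum_(k | A k) l k *: x k) = \sum_(k | A k) l k * bary i (x k).
Proof.
move=> l1; rewrite /bary.
have -> : \sum_(k | A k) l k *: x k - p ord0
    = \sum_(k | A k) l k *: (x k - p ord0).
  under [RHS]eq_bigr do rewrite scalerBr.
  by rewrite sumrB -scaler_suml l1 scale1r.
rewrite dot_sumr -[_%:R in LHS]mul1r -l1 mulr_suml -big_split /=.
by apply: eq_bigr => k _; rewrite dotZr mulrDr.
Qed.

Lemma bary_lift j x :
  bary (lift ord0 j) x = (invmx (edge_mx p) *m (x - p ord0)) j 0.
Proof.
rewrite /bary addr0 qvec_lift dotE mxE; apply: eq_bigr => k _.
by rewrite !mxE.
Qed.

Lemma bary_recon x : \sum_i bary i x *: p i = x.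
Proof.
rewrite -[RHS](subrK (p ord0)) big_ord_recl.
have -> : bary ord0 x = 1 - \sum_j bary (lift ord0 j) x.
  by rewrite -(bary_sum x) big_ord_recl addrK.
rewrite scalerBl scale1r -addrA addrC; congr (_ + _).
rewrite scaler_suml addrC -sumrB -[RHS](mulKVmx hp).
apply/colP => i; rewrite summxE mxE; apply: eq_bigr => j _.
by rewrite bary_lift -scalerBr !mxE mulrC.
Qed.

Lemma bary_vert i k : bary i (p k) = (i == k)%:R.
Proof.
have lift_case j : bary (lift ord0 j) (p k) = (lift ord0 j == k)%:R.
  rewrite bary_lift; case: (unliftP ord0 k) => [l|] ->.
    have -> : p (lift ord0 l) - p ord0 = col l (edge_mx p).
      by apply/colP => a; rewrite !mxE.
    by rewrite colE mulKmx // !mxE andbT (inj_eq lift_inj).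
  by rewrite subrr mulmx0 mxE eq_sym eq_liftF.
case: (unliftP ord0 i) => [j|] -> //.
have := bary_sum (p k); rewrite big_ord_recl => /(canRL (addrK _)) ->.
rewrite (eq_bigr _ (fun j _ => lift_case j)).
case: (unliftP ord0 k) => [l|] ->.
  rewrite (bigD1 l) //= eqxx big1 ?addr0 ?subrr // => j jl.
  by rewrite (inj_eq lift_inj) (negbTE jl).
by rewrite big1 ?subr0 ?eqxx.
Qed.

Lemma bary_uniq (l : 'I_d.+1 -> R) i :
  \sum_k l k = 1 -> bary i (\sum_k l k *: p k) = l i.
Proof.
move=> l1; rewrite bary_comb // (bigD1 i) //= bary_vert eqxx mulr1.
rewrite big1 ?addr0 // => k ki.
by rewrite bary_vert eq_sym (negbTE ki) mulr0.
Qed.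

Lemma simplexP x : simplex p x <-> forall i, 0 <= bary i x.
Proof.
split=> [[l [l0 l1 ->]] i|x0].
  move: l1; rewrite (eq_bigl predT) => [l1|k]; last by rewrite inE.
  rewrite (eq_bigl predT) => [|k]; last by rewrite inE.
  by rewrite bary_uniq // l0 ?inE.
exists (bary^~ x); split=> //.
  by rewrite (eq_bigl predT) ?bary_sum // => k; rewrite inE.
by rewrite (eq_bigl predT) ?bary_recon // => k; rewrite inE.
Qed.

Lemma vert_in_simplex i : simplex p (p i).
Proof. by apply/simplexP => j; rewrite bary_vert. Qed.

Lemma bary_convex i t x y :
  bary i ((1 - t) *: x + t *: y) = (1 - t) * bary i x + t * bary i y.
Proof.
have -> : (1 - t) *: x + t *: y = x + t *: (y - x).
  by rewrite scalerBl scale1r scalerBr -addrA (addrC (- _)).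
by rewrite /bary !dotBr dotDr dotZr dotBr; ring.
Qed.

Lemma dot_sum_qvec (v : 'I_d.+1 -> R) x y :
  dot (\sum_i v i *: qvec p i) (x - y)
    = \sum_i bary i x * v i - \sum_i bary i y * v i.
Proof.
rewrite dot_suml -sumrB; apply: eq_bigr => i _.
by rewrite dotZl -bary_diff mulrBr !(mulrC (v i)).
Qed.

Lemma affine_bary (v : 'cV[R]_d -> R) x :
  affine_on (simplex p) v -> simplex p x ->
  v x = \sum_i bary i x * v (p i).
Proof.
move=> [g [c vE]] xp; rewrite vE // -{1}(bary_recon x) dot_sumr.
rewrite -[c]mul1r -(bary_sum x) mulr_suml -big_split /=.
by apply: eq_bigr => i _; rewrite vE ?dotZr -?mulrDr //; exact: vert_in_simplex.
Qed.

End Barycentric.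

(** * Topology of simplices and gradients of interpolants *)

Section Topology.
Variables (R : realType) (d : nat) (p : 'I_d.+1 -> 'cV[R]_d).
Hypothesis hp : nondeg_simplex p.

Lemma dot_continuous (u : 'cV[R]_d) : continuous (dot u : 'cV[R]_d -> R).
Proof.
have -> : (dot u : 'cV[R]_d -> R) = (fun v : 'cV[R]_d => \sum_i u i 0 * v i 0).
  by apply/funext => v; rewrite dotE.
apply: continuous_big => [|i _]; first exact: add_continuous.
move=> v; apply: (@cvgM R 'cV[R]_d (nbhs v) _ (cst (u i 0)) (fun v => v i 0)).
  exact: cvg_cst.
exact: coord_continuous.
Qed.

Lemma bary_continuous i : continuous (bary p i).
Proof.
have -> : bary p i
    = dot (qvec p i) \+ cst ((i == ord0)%:R - dot (qvec p i) (p ord0)).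
  by apply/funext => x; rewrite /bary dotBr /=; ring.
move=> x; apply: (@cvgD R _ _ (nbhs x) _ (dot (qvec p i)) (cst _)).
  exact: dot_continuous.
exact: cvg_cst.
Qed.

Lemma near_bary_gt0 i x : 0 < bary p i x -> \forall y \near x, 0 < bary p i y.
Proof.
move=> h; apply: (@cvgr_gt R _ (nbhs x) _ (bary p i) (bary p i x)) => //.
exact: bary_continuous. Qed.

Lemma simplex_closed : closed (simplex p).
Proof.
have -> : simplex p = \bigcap_(i in setT) [set x | 0 <= bary p i x].
  apply/seteqP; split=> x; first by move=> /(simplexP hp) h i _; exact: h.
  by move=> h; apply/(simplexP hp) => i; exact: h.
apply: closed_bigI => i _.
apply: (@preimage_closed _ _ (bary p i) [set y | 0 <= y]) => [y _|].
  exact: bary_continuous.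
exact: closed_ge.
Qed.

(** All barycentric coordinates of the centroid are positive, which persists
    nearby; derivatives at the centroid therefore see only the values on the
    simplex. *)
Lemma centroid_interior : \forall x \near centroid p, simplex p x.
Proof.
have cE i : bary p i (centroid p) = d.+1%:R^-1.
  rewrite /centroid scaler_sumr; apply: (bary_uniq hp (l := fun=> _)).
  by rewrite sumr_const card_ord -[LHS]mulr_natr mulVf ?pnatr_eq0.
have : \forall x \near centroid p, forall i, 0 < bary p i x.
  apply: (@filter_forall _ _ (fun i x => 0 < bary p i x)
    _ (nbhs_filter _)) => i.
  apply: near_bary_gt0.
  by rewrite cE invr_gt0 ltr0n.
by apply: filterS => x x0; apply/(simplexP hp) => i; rewrite ltW.
Qed.

Lemma derive_affine (u : 'cV[R]_d) c x y :
  'D_y (fun z : 'cV[R]_d => dot u z + c : R) x = dot u y.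
Proof.
rewrite /derive; apply/cvg_lim => //.
apply: cvg_near_cst; near=> h.
rewrite /= dotDr dotZr.
have -> : h * dot u y + dot u x + c - (dot u x + c) = h * dot u y by ring.
rewrite /GRing.scale /= mulKf //; near: h.
exact: nbhs_dnbhs_neq.
Unshelve. all: by end_near. Qed.

Lemma grad_interp (v : 'cV[R]_d -> R) (V : 'I_d.+1 -> R) :
  (forall x, simplex p x -> v x = \sum_i bary p i x * V i) ->
  grad v (centroid p) = \sum_i V i *: qvec p i.
Proof.
move=> vE; apply/colP => i; rewrite mxE -dot_deltar.
set g := \sum_i _; pose c := \sum_i bary p i 0 * V i.
rewrite -(derive_affine g c (centroid p)); apply: near_eq_derive.
apply: filterS centroid_interior => x xp.
rewrite vE // -[X in dot g X]subr0 dot_sum_qvec //.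
by rewrite subrK.
Qed.

End Topology.

(** * Stiffness entries of one element *)

Section Element.
Variables (R : realType) (d : nat).

Lemma nonobtuse_dot_le0 (p : 'I_d.+1 -> 'cV[R]_d) i j :
  nonobtuse p -> i != j -> dot (qvec p i) (qvec p j) <= 0.
Proof.
move=> hp /hp; rewrite /dihedral_angle.
set u := qvec p i; set v := qvec p j; set n := enorm u * enorm v.
have n0 : 0 <= n by rewrite mulr_ge0 // sqrtr_ge0.
have CS : `|dot u v| <= n := cauchy_schwarz u v.
(* A zero vector has no angle, but then the product is 0. *)
have [nz|nz] := eqVneq n 0.
  by move=> _; move: CS; rewrite nz normr_le0 => /eqP ->.
have np : 0 < n by rewrite lt_def nz.
have bounds : -1 <= - dot u v / n <= 1.
  by rewrite -ler_norml normrM normrN normfV (gtr0_norm np) ler_pdivrMr ?mul1r.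
have [/andP[a0 _] acosE] := acos_def bounds => api.
have : 0 <= - dot u v / n.
  rewrite -acosE; apply: cos_ge0_pihalf; rewrite api andbT.
  by apply: le_trans a0; rewrite oppr_le0 divr_ge0 ?pi_ge0.
by rewrite pmulr_lge0 ?invr_gt0 // oppr_ge0.
Qed.

(** Since the [q i] sum to 0, [U] may be shifted by [c] on the right.  The right
    side minus the left side is then the sum over [i] and [j] of the terms
    [- V i * (U j - c)^- * dot (q i) (A *m q j)], which vanish for [i = j], as a
    positive and a negative part do not meet, and are nonnegative otherwise. *)
Lemma energy_truncation n (q : 'I_n -> 'cV[R]_d) (A : 'M[R]_d)
    (U V : 'I_n -> R) c :
  \sum_i q i = 0 ->
  (forall i j, i != j -> dot (q i) (A *m q j) <= 0) ->
  (forall i, V i = Num.max (U i - c) 0) ->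
  dot (\sum_i V i *: q i) (A *m \sum_i V i *: q i)
    <= dot (\sum_i V i *: q i) (A *m \sum_i U i *: q i).
Proof.
move=> q0 A_le0 VE; pose g (W : 'I_n -> R) := \sum_i W i *: q i.
have -> : \sum_i U i *: q i = g (fun i => U i - c).
  rewrite /g; under [RHS]eq_bigr do rewrite scalerBl.
  by rewrite sumrB -scaler_sumr q0 scaler0 subr0.
rewrite -!/(g V).
have gE W W' : dot (g W) (A *m g W')
    = \sum_i \sum_j W i * W' j * dot (q i) (A *m q j).
  rewrite /g mulmx_sumr dot_suml; apply: eq_bigr => i _.
  rewrite dot_sumr; apply: eq_bigr => j _.
  by rewrite -scalemxAr dotZl dotZr mulrA.
rewrite !gE; apply: ler_sum => i _; apply: ler_sum => j _.
have [<-|/A_le0 a_le0] := eqVneq i j.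
  suff -> : V i * V i = V i * (U i - c) by [].
  by rewrite VE; case: (leP (U i - c) 0) => _ //; rewrite !mul0r.
by rewrite ler_wnM2r // ler_wpM2l // VE le_max lexx ?orbT.
Qed.

Lemma aff_comb (I : finType) (F : affine_map R d) (l : I -> R)
    (x : I -> 'cV[R]_d) :
  \sum_k l k = 1 -> aff F (\sum_k l k *: x k) = \sum_k l k *: aff F (x k).
Proof.
move=> l1; rewrite /aff; under [RHS]eq_bigr do rewrite scalerDr scalemxAr.
by rewrite big_split /= mulmx_sumr -scaler_suml l1 scale1r.
Qed.

Variables (ahat a : 'I_d.+1 -> 'cV[R]_d) (F : affine_map R d).
Hypothesis hahat : nondeg_simplex ahat.
Hypothesis ha : nondeg_simplex a.
Hypothesis hF : aff F @` simplex ahat = simplex a.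

(** The matrix of [F] in barycentric coordinates of both simplices. *)
Let P i k := bary a i (aff F (ahat k)).

Lemma preimage_vertices : exists y : 'I_d.+1 -> 'cV[R]_d,
  forall i, simplex ahat (y i) /\ aff F (y i) = a i.
Proof.
suff /choice[y hy] : forall i, exists y, simplex ahat y /\ aff F y = a i.
  by exists y.
move=> i.
have : simplex a (a i) := vert_in_simplex ha i.
by rewrite -hF => -[y]; exists y.
Qed.

(** The edges of [a] are images under [jac F] of differences of preimages, and
    the edges of a nondegenerate simplex are independent. *)
Lemma jac_unit : jac F \in unitmx.
Proof.
have [y hy] := preimage_vertices.
have E : edge_mx a = jac F *m (\matrix_(i, j) (y (lift ord0 j) - y ord0) i 0).
  apply/matrixP => i j; rewrite [LHS]mxE.
  rewrite -(proj2 (hy ord0)) -(proj2 (hy (lift ord0 j))) /aff.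
  rewrite opprD addrACA subrr addr0 -mulmxBr !mxE.
  by apply: eq_bigr => k _; rewrite !mxE.
by move: ha; rewrite /nondeg_simplex E unitmx_mul => /andP[].
Qed.

(** Chain rule: [bary a i \o aff F] is affine with values [P i k] at the
    reference vertices. *)
Lemma trjac_qvec i : (jac F)^T *m qvec a i = \sum_k P i k *: qvec ahat k.
Proof.
apply: dot_ext => x; rewrite -dot_mulmx.
have affE y : bary a i (aff F y) = \sum_k bary ahat k y * P i k.
  rewrite -[in LHS](bary_recon hahat y) aff_comb ?bary_sum //.
  by rewrite bary_comb ?bary_sum.
rewrite -[x in RHS]subr0 dot_sum_qvec -!affE bary_diff /aff.
by rewrite mulmx0 add0r addrK.
Qed.

Lemma pullback_ge0 i k : 0 <= P i k.
Proof.
have : simplex a (aff F (ahat k)).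
  by rewrite -hF; exists (ahat k) => //; exact: vert_in_simplex.
by move/(simplexP ha)/(_ i).
Qed.

(** The inverse [Q] of [P] collects the coordinates of the preimages of the
    vertices [a j], so it is nonnegative too.  A nonnegative matrix with a
    nonnegative inverse has at most one nonzero entry in each column. *)
Lemma pullback_disjoint i j k : i != j -> P i k * P j k = 0.
Proof.
have [y hy] := preimage_vertices.
pose Q k j := bary ahat k (y j).
have Q_ge0 k' j' : 0 <= Q k' j'.
  by have [/(simplexP hahat) /(_ k')] := hy j'.
have PQ i' j' : \sum_k P i' k * Q k j' = (i' == j')%:R.
  rewrite -(bary_vert ha) -(proj2 (hy j')) -[in RHS](bary_recon hahat (y j')).
  rewrite aff_comb ?bary_sum // bary_comb ?bary_sum //.
  by apply: eq_bigr => l _; rewrite mulrC.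
have QP : \sum_i Q k i * P i k = 1.
  pose PM := \matrix_(i, k) P i k; pose QM := \matrix_(k, i) Q k i.
  have : PM *m QM = 1%:M.
    apply/matrixP => i' j'; rewrite !mxE -PQ.
    by apply: eq_bigr => l _; rewrite !mxE.
  move=> /mulmx1C /matrixP /(_ k k); rewrite !mxE eqxx => QP1.
  transitivity (true%:R : R) => //; rewrite -QP1.
  by apply: eq_bigr => l _; rewrite !mxE.
(* A nonzero entry in row k of Q isolates the one row where column k of P may
   be nonzero. *)
have [i0 Qi0] : exists i0, Q k i0 != 0.
  apply: contrapT => h; move: QP; rewrite big1 => [/eqP|l _].
    by rewrite eq_sym oner_eq0.
  have [->|Ql] := eqVneq (Q k l) 0; first by rewrite mul0r.
  by case: h; exists l.
have P0 l : l != i0 -> P l k = 0.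
  move=> li0; have /eqP := PQ l i0.
  rewrite (negbTE li0) psumr_eq0 => [/allP|l' _].
    move=> /(_ k (mem_index_enum _)); rewrite mulf_eq0 (negbTE Qi0) orbF.
    by move/eqP.
  by rewrite mulr_ge0 // pullback_ge0.
move=> ij; have [ii0|/P0 ->] := eqVneq i i0; last by rewrite mul0r.
by rewrite (P0 j) ?mulr0 // -ii0 eq_sym.
Qed.

Variables (A : 'M[R]_d) (C : R).
Hypothesis hC : 0 < C.
Hypothesis hA : invmx (jac F) *m A *m (invmx (jac F))^T = C%:M.

(** Solving the mesh condition for [A] gives [A = C *: (jac F *m (jac F)^T)]. *)
Lemma dot_diffusion u v :
  dot u (A *m v) = C * dot ((jac F)^T *m u) ((jac F)^T *m v).
Proof.
have AE : A = C *: (jac F *m (jac F)^T).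
  rewrite scalemxAl -mul_mx_scalar -hA !mulmxA mulmxV ?jac_unit // mul1mx.
  by rewrite trmx_inv mulmxKV // unitmx_tr jac_unit.
by rewrite AE -scalemxAl dotZr -mulmxA dot_mulmx.
Qed.

Lemma energy_ge0 u : 0 <= dot u (A *m u).
Proof. by rewrite dot_diffusion mulr_ge0 ?dot_ge0 // ltW. Qed.

Lemma energy_eq0 u : dot u (A *m u) = 0 -> u = 0.
Proof.
rewrite dot_diffusion => /eqP; rewrite mulf_eq0 gt_eqF //= => /eqP /dot_eq0.
move/(congr1 (mulmx (invmx (jac F)^T))).
by rewrite mulKmx ?unitmx_tr ?jac_unit // mulmx0.
Qed.

Hypothesis hangle : nonobtuse ahat.

(** Expanded in the reference normals, the diagonal terms vanish by
    [pullback_disjoint] and the other ones are nonpositive by the angle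
    condition. *)
Lemma stiffness_le0 i j : i != j -> dot (qvec a i) (A *m qvec a j) <= 0.
Proof.
move=> ij; rewrite dot_diffusion mulr_ge0_le0 ?(ltW hC) // !trjac_qvec.
rewrite dot_suml sumr_le0 // => k _; rewrite dot_sumr sumr_le0 // => l _.
rewrite dotZl dotZr mulrA.
have [->|kl] := eqVneq k l; first by rewrite pullback_disjoint // mul0r.
by rewrite mulr_ge0_le0 ?nonobtuse_dot_le0 // mulr_ge0 // pullback_ge0.
Qed.

End Element.

(** * Finite element functions on a triangulation *)

Section Mesh.
Variables (R : realType) (d : nat) (Omega : set 'cV[R]_d) (M : mesh R d).
Variable phi : 'I_(nv M) -> 'cV[R]_d -> R.
Hypothesis hOmega : polytopal_domain Omega.
Hypothesis hM : triangulation Omega M.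
Hypothesis hphi : forall j : 'I_(nv M), basis_function Omega j (phi j).

Let nondeg K : nondeg_simplex (evert K) := tri_nondegenerate hM K.

Lemma cell_closure (K : elt M) x : cell K x -> closure Omega x.
Proof. by move=> xK; rewrite (tri_cover hM); exists K. Qed.

Lemma closure_cell x : closure Omega x -> exists K : elt M, cell K x.
Proof. by rewrite (tri_cover hM) => -[K _ xK]; exists K. Qed.

Lemma fe_on_cell (U : 'I_(nv M) -> R) (K : elt M) x : cell K x ->
  fe_fun phi U x = \sum_i bary (evert K) i x * U (loc K i).
Proof.
move=> xK; rewrite /fe_fun.
under eq_bigr do
  rewrite (affine_bary (nondeg K) (basis_affine (hphi _) K) xK) mulr_sumr.
rewrite exchange_big /=; apply: eq_bigr => i _.
rewrite (bigD1 (loc K i)) //= (basis_vert (hphi _)) eqxx mulr1 mulrC.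
rewrite big1 ?addr0 // => j jN.
by rewrite (basis_vert (hphi _)) eq_sym (negbTE jN) !mulr0.
Qed.

Lemma fe_vert (U : 'I_(nv M) -> R) j : fe_fun phi U (vert j) = U j.
Proof.
rewrite /fe_fun (bigD1 j) //= (basis_vert (hphi _)) eqxx mulr1.
rewrite big1 ?addr0 // => i ij.
by rewrite (basis_vert (hphi _)) eq_sym (negbTE ij) mulr0.
Qed.

Lemma fe_le (U : 'I_(nv M) -> R) c x :
  (forall j, U j <= c) -> closure Omega x -> fe_fun phi U x <= c.
Proof.
move=> Uc /closure_cell[K xK]; rewrite (fe_on_cell _ xK).
rewrite -[c]mul1r -(bary_sum (evert K) x) mulr_suml; apply: ler_sum => i _.
by rewrite ler_wpM2l //; move/(simplexP (nondeg K)): xK; apply.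
Qed.

Lemma fe_ge0 (U : 'I_(nv M) -> R) x :
  (forall j, 0 <= U j) -> closure Omega x -> 0 <= fe_fun phi U x.
Proof.
move=> U0 /closure_cell[K xK]; rewrite (fe_on_cell _ xK).
rewrite sumr_ge0 // => i _; rewrite mulr_ge0 //.
by move/(simplexP (nondeg K)): xK; apply.
Qed.

Lemma grad_fe (U : 'I_(nv M) -> R) (K : elt M) :
  grad_on K (fe_fun phi U) = \sum_i U (loc K i) *: qvec (evert K) i.
Proof.
apply: (grad_interp (nondeg K) (V := fun i => U (loc K i))) => x.
exact: fe_on_cell.
Qed.

Lemma open_segment (a v : 'cV[R]_d) :
  Omega a -> exists t : R, [/\ 0 < t, t < 1 & Omega (a + t *: v)].
Proof.
move=> aO.
have cv : (a + t *: v) @[t --> (0:R)^'+] --> a.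
  rewrite -[X in _ --> X]addr0 -(scale0r v); apply: cvgD; first exact: cvg_cst.
  apply: cvgZr_tmp; apply: cvg_at_right_filter; exact: cvg_id.
have near_O : \forall t \near (0:R)^'+, Omega (a + t *: v).
  by apply: cv; apply: open_nbhs_nbhs; split=> //; exact: domain_open hOmega.
near (0:R)^'+ => t; exists t; split; near: t => //.
- exact: nbhs_right_gt.
- exact: nbhs_right_lt.
Unshelve. all: by end_near. Qed.

(** A vertex that is extreme in some coordinate direction cannot be interior:
    the closure of [Omega] is covered by convex hulls of vertices, so it does not
    extend further in that direction. *)
Lemma exists_boundary_vertex :
  (0 < d)%N -> exists j : 'I_(nv M), (nvi M <= j)%N.
Proof.
move=> d0; pose i0 := Ordinal d0.
have [x0 x0O] := domain_nonempty hOmega.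
have [K0 _] := closure_cell (subset_closure x0O).
pose h (j : 'I_(nv M)) := vert j i0 0.
case: (@arg_maxP _ _ _ (loc K0 ord0) predT h isT) => j _ hj.
exists j; rewrite leqNgt; apply/negP => /(tri_interior hM) jO.
have [t [t0 _ tO]] := open_segment (delta_mx i0 0) jO.
have [K zK] := closure_cell (subset_closure tO).
set z := vert j + _ in tO zK.
have : z i0 0 <= h j.
  rewrite -{1}(bary_recon (nondeg K) z) summxE.
  rewrite -[h j]mul1r -(bary_sum (evert K) z) mulr_suml.
  apply: ler_sum => i _; rewrite mxE ler_wpM2l //; last exact: hj.
  by move/(simplexP (nondeg K)): zK; apply.
by rewrite /z !mxE !eqxx mulr1 /h; apply/negP; rewrite -ltNge ltrDl.
Qed.

(** By conformity, [y] is a convex combination of vertices of both elements. *)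
Lemma bary_common_face (K K' : elt M) i y :
  cell K y -> cell K' y -> loc K i \notin vset K' -> bary (evert K) i y = 0.
Proof.
move=> yK yK' iN; have : (cell K `&` cell K') y by [].
rewrite (tri_conforming hM) => -[l [_ l1 ->]].
rewrite bary_comb // big1 // => m; rewrite inE => /andP[mK mK'].
move/imsetP: mK => [k _ mE]; rewrite mE -/(evert K k) (bary_vert (nondeg K)).
case: eqVneq => [ik|_]; last by rewrite mulr0.
by move: iN; rewrite ik -mE mK'.
Qed.

(** The basis function of an interior vertex [a] vanishes on the boundary.

    Let [x] have a positive coordinate at [a], and contract towards [a] by
    [h z = (1 - t) a + t z], with [t] so small that [h x] is in [Omega].  For [z]
    close to [x], [h z] lies in [Omega], hence in some element [K'], which also
    contains [h x].  Elements meet in common faces, so [K'] has [a] and all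
    vertices of the face carrying [x] among its own.  Undoing the contraction
    multiplies the coordinates of [h z] in [K'] by a positive factor, except the
    one at [a], and that one stays positive by continuity.  So [z] is in [K'],
    and a neighbourhood of [x] lies in the closure of [Omega], that is [x] is in
    [Omega] since [Omega] has no slits. *)
Lemma interior_basis_support j x :
  Omega (vert j) -> closure Omega x -> phi j x != 0 -> Omega x.
Proof.
move=> jO /closure_cell[K xK] phix.
have bK := (simplexP (nondeg K) _).1 xK.
have [i [ij bi0]] : exists i, loc K i = j /\ 0 < bary (evert K) i x.
  apply: contrapT => h; move: phix.
  rewrite (affine_bary (nondeg K) (basis_affine (hphi j) K) xK).
  rewrite big1 ?eqxx // => i _.
  rewrite (basis_vert (hphi j)); case: eqVneq => [ij|_]; last by rewrite mulr0.
  have [->|bi] := eqVneq (bary (evert K) i x) 0; first by rewrite mul0r.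
  by case: h; exists i; split=> //; rewrite lt_def bi bK.
set a := vert j; have aE : a = evert K i by rewrite /evert ij.
have [t [t0 t1 yO]] := open_segment (x - a) jO.
pose h (z : 'cV[R]_d) := (1 - t) *: a + t *: z.
have hE z : h z = a + t *: (z - a).
  by rewrite /h scalerBl scale1r scalerBr -addrA (addrC (- _)).
have bh (K' : elt M) k z : bary (evert K') k (h z)
    = (1 - t) * bary (evert K') k a + t * bary (evert K') k z.
  exact: bary_convex.
have yK : cell K (h x).
  apply/(simplexP (nondeg K)) => k; rewrite bh.
  rewrite addr_ge0 // mulr_ge0 ?bK ?(ltW t0) ?subr_ge0 ?(ltW t1) //.
  by rewrite aE (bary_vert (nondeg K)).
rewrite -(domain_regular hOmega).
have near1 : \forall z \near x, Omega (h z).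
  have hc : h z @[z --> x] --> h x.
    apply: (@cvgD R _ _ (nbhs x) _ (cst ((1 - t) *: a)) ( *:%R t)).
      exact: cvg_cst.
    exact: scaler_continuous.
  apply: hc; apply: open_nbhs_nbhs; split; last by rewrite hE.
  exact: domain_open hOmega.
(* Elements that miss h x also miss h z: there are finitely many of them, and
   each is cut off by a coordinate that is negative at h x. *)
have near2 : \forall z \near x, forall Kk : elt M * 'I_d.+1,
    bary (evert Kk.1) Kk.2 (h x) < 0 -> bary (evert Kk.1) Kk.2 (h z) < 0.
  apply: (@filter_forall _ _ (fun Kk z => _ -> bary (evert Kk.1) Kk.2 (h z) < 0)
    _ (nbhs_filter _)) => -[K' k] /=.
  have [|lt0] := boolP (bary (evert K') k (h x) < 0); last first.
    by apply: nearW => z.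
  rewrite bh -ltrBrDl sub0r mulrC -ltr_pdivlMr // => lt0.
  have : \forall z \near x,
      bary (evert K') k z < - ((1 - t) * bary (evert K') k a) / t.
    apply: (@cvgr_lt R _ (nbhs x) _ _ (bary (evert K') k x)) => //.
    exact: bary_continuous.
  by apply: filterS => z zlt _; rewrite bh -ltrBrDl sub0r mulrC -ltr_pdivlMr.
have near3 : \forall z \near x, forall Kk : elt M * 'I_d.+1,
    0 < bary (evert Kk.1) Kk.2 x -> 0 < bary (evert Kk.1) Kk.2 z.
  apply: (@filter_forall _ _ (fun Kk z => _ -> 0 < bary (evert Kk.1) Kk.2 z)
    _ (nbhs_filter _)) => -[K' k] /=.
  have [gt0|_] := boolP (0 < bary (evert K') k x); last by apply: nearW => z.
  by apply: filterS (near_bary_gt0 gt0).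
apply: filterS3 near1 near2 near3 => z zO z2 z3.
have [K' zK'] := closure_cell (subset_closure zO).
have yK' : cell K' (h x).
  apply/(simplexP (nondeg K')) => k; rewrite leNgt.
  apply/negP => /(z2 (K', k)) /=.
  by rewrite ltNge ((simplexP (nondeg K') _).1 zK').
(* bary K k (h x) is a combination of the two nonnegative coordinates with
   positive weights. *)
have zero_outside k : loc K k \notin vset K' ->
    bary (evert K) k x = 0 /\ bary (evert K) k a = 0.
  move=> kN; have /eqP := bary_common_face yK yK' kN.
  have ba : 0 <= bary (evert K) k a by rewrite aE (bary_vert (nondeg K)).
  have t1' : 0 < 1 - t by rewrite subr_gt0.
  rewrite bh paddr_eq0 ?mulr_ge0 ?bK ?(ltW t0) ?(ltW t1') //.
  by rewrite !mulf_eq0 (gt_eqF t0) (gt_eqF t1') => /andP[/eqP -> /eqP ->].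
have [k0 jE] : exists k0, a = evert K' k0.
  have [/imsetP[k0 _ jE]|/zero_outside [_]] := boolP (loc K i \in vset K').
    by exists k0; rewrite aE /evert jE.
  by rewrite aE (bary_vert (nondeg K)) eqxx => /eqP; rewrite oner_eq0.
(* The coordinate of x at a in K' is at least the one in K. *)
have bk0 : 0 < bary (evert K') k0 x.
  rewrite -[x in X in _ < X](bary_recon (nondeg K)) bary_comb ?bary_sum //.
  rewrite (bigD1 i) //= -aE jE (bary_vert (nondeg K')) eqxx mulr1.
  rewrite ltr_pwDl // sumr_ge0 // => k _.
  have [/imsetP[k' _ kE]|/zero_outside[-> _]] := boolP (loc K k \in vset K').
    by rewrite /evert kE -/(evert K' k') (bary_vert (nondeg K')) mulr_ge0 ?bK.
  by rewrite mul0r.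
apply: (@cell_closure K'); apply/(simplexP (nondeg K')) => k.
have [->|kk0] := eqVneq k k0; first by rewrite ltW // (z3 (K', k0)).
have := (simplexP (nondeg K') _).1 zK' k.
by rewrite bh jE (bary_vert (nondeg K')) (negbTE kk0) mulr0 add0r pmulr_rge0.
Qed.

(** The union of the elements on which the function vanishes and that of the
    other ones are closed and disjoint, and cover the connected closure of
    [Omega]. *)
Lemma locally_constant_eq0 (V : 'I_(nv M) -> R) j0 :
  (forall (K : elt M) i i', V (loc K i) = V (loc K i')) -> V j0 = 0 ->
  forall j, V j = 0.
Proof.
move=> Vconst Vj0.
have feV K x : cell K x -> fe_fun phi V x = V (loc K ord0).
  move=> xK; rewrite (fe_on_cell _ xK).
  under eq_bigr do rewrite (Vconst _ _ ord0).
  by rewrite -mulr_suml bary_sum mul1r.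
pose C (P : set R) := \bigcup_(K in [set K : elt M | P (V (loc K ord0))]) cell K.
have C_closed P : closed (C P).
  apply: closed_bigcup => [|K _]; first exact: finite_finset.
  exact: simplex_closed (nondeg K).
have vcl (j : 'I_(nv M)) : closure Omega (vert j).
  have [K /imsetP[i _ ->]] := tri_vert_used hM j.
  apply: (@cell_closure K); exact: vert_in_simplex (nondeg K) i.
have CE : closure Omega `&` C [set 0] = closure Omega.
  apply: (connected_closure (domain_connected hOmega)).
  - exists (vert j0); split; first exact: vcl.
    have [K xK] := closure_cell (vcl j0).
    by exists K => //=; rewrite -(feV _ _ xK) fe_vert.
  - exists (~` C [set r | r != 0]); first exact: closed_openC.
    apply/seteqP; split=> x [xc].
      move=> [K /= K0 xK]; split=> // -[K' /= /eqP + xK'].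
      by rewrite -(feV _ _ xK') (feV _ _ xK).
    move=> xN; split=> //; have [K xK] := closure_cell xc.
    exists K => //=; apply: contrapT => K0; apply: xN.
    by exists K => //=; apply/eqP.
  - by exists (C [set 0]).
move=> j; have := vcl j; rewrite -CE => -[_ [K /= K0 xK]].
by rewrite -fe_vert (feV _ _ xK).
Qed.

End Mesh.

(** * The discrete maximum principle *)

Theorem corollary2p1 (R : realType) (d : nat) (Omega : set 'cV[R]_d)
    (f g : 'cV[R]_d -> R) (D : 'cV[R]_d -> 'M[R]_d)
    (M : mesh R d) (phi : 'I_(nv M) -> 'cV[R]_d -> R)
    (ahat : 'I_d.+1 -> 'cV[R]_d) (F : elt M -> affine_map R d)
    (m : nat) (w : 'I_m -> R) (bhat : 'I_m -> 'cV[R]_d)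
    (hd : (1 <= d <= 3)%N)
    (hOmega : polytopal_domain Omega)
    (hD : forall x, Omega x -> spd (D x))
    (hM : triangulation Omega M)
    (hphi : forall j : 'I_(nv M), basis_function Omega j (phi j))
    (hahat : nondeg_simplex ahat)
    (hF : forall K : elt M, aff (F K) @` simplex ahat = cell K)
    (hquad : quadrature_rule (simplex ahat) w bhat)
    (hangle : nonobtuse ahat)
    (hmesh : forall K : elt M, exists2 C : R, 0 < C &
       invmx (jac (F K)) *m DK D (F K) w bhat *m (invmx (jac (F K)))^T
         = C%:M) :
  satisfies_dmp Omega f g D phi F w bhat.
Proof.
move=> f_le0 U [_ scheme]; set u := fe_fun phi U.
set c := Num.max 0 (sup (u @` boundary Omega)).
have nondeg K : nondeg_simplex (evert K) := tri_nondegenerate hM K.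
have U_boundary (j : 'I_(nv M)) : (nvi M <= j)%N -> U j <= c.
  move=> jb; rewrite le_max; apply/orP; right; apply: ub_le_sup.
    exists (\sum_i `|U i|) => _ [x [xc _] <-].
    apply: (fe_le hM hphi _ xc) => i; apply: le_trans (ler_norm _) _.
    by rewrite (bigD1 i) //= lerDl sumr_ge0.
  exists (vert j); first exact: (tri_boundary hM).
  exact: (fe_vert hphi).
(* The nodal values of the test function. *)
pose V j := Num.max (U j - c) 0.
have V_ge0 j : 0 <= V j by rewrite le_max lexx orbT.
have V_boundary (j : 'I_(nv M)) : (nvi M <= j)%N -> V j = 0.
  by move=> /U_boundary Uj; apply/max_idPr; rewrite subr_le0.
have vE : fe_fun phi V
    = fun x => \sum_(j : 'I_(nv M) | (j < nvi M)%N) V j * phi j x.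
  apply/funext => x; rewrite /fe_fun [RHS]big_mkcond; apply: eq_bigr => j _.
  by case: ltnP => // /V_boundary ->; rewrite mul0r.
have /scheme : U0h phi (fe_fun phi V) by exists V.
pose A K := DK D (F K) w bhat.
pose e K := dot (grad_on K (fe_fun phi V)) (A K *m grad_on K (fe_fun phi V)).
move=> scheme_v.
have vol_gt0 (K : elt M) : 0 < simplex_vol (evert K).
  rewrite divr_gt0 ?ltr0n ?fact_gt0 // normr_gt0.
  by have := nondeg K; rewrite /nondeg_simplex unitmxE unitfE.
have load_le0 : \sum_(K : elt M) simplex_vol (evert K) *
    \sum_k w k * f (aff (F K) (bhat k)) * fe_fun phi V (aff (F K) (bhat k)) <= 0.
  apply: sumr_le0 => K _; rewrite mulr_ge0_le0 ?(ltW (vol_gt0 K)) //.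
  apply: sumr_le0 => k _; set x := aff (F K) (bhat k).
  have xc : closure Omega x.
    apply: (cell_closure hM (K := K)); rewrite -hF; exists (bhat k) => //.
    exact: quad_nodes hquad k.
  (* On the boundary the sign of f is unknown, but the test function is 0. *)
  have [xO|xO] := pselect (Omega x).
    rewrite mulr_le0_ge0 ?(fe_ge0 hM hphi) //.
    by rewrite mulr_ge0_le0 ?(quad_ge0 hquad) ?f_le0.
  suff -> : fe_fun phi V x = 0 by rewrite mulr0.
  rewrite vE big1 // => j ji; have [->|phix] := eqVneq (phi j x) 0.
    by rewrite mulr0.
  case: xO; apply: (interior_basis_support hOmega hM hphi _ xc phix).
  exact: (tri_interior hM).
have e_ge0 K : 0 <= e K.
  have [C C0 hC] := hmesh K.
  exact: (energy_ge0 (nondeg K) (hF K) C0 hC).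
have e_le K : e K <= dot (grad_on K (fe_fun phi V)) (A K *m grad_on K u).
  have [C C0 hC] := hmesh K.
  rewrite /e /u !(grad_fe hM hphi).
  apply: (energy_truncation (c := c)); first exact: sum_qvec.
    by move=> i j; exact: (stiffness_le0 hahat (nondeg K) (hF K) C0 hC hangle).
  by [].
have sum_e : \sum_(K : elt M) simplex_vol (evert K) * e K <= 0.
  apply: le_trans load_le0; rewrite -scheme_v; apply: ler_sum => K _.
  by rewrite ler_wpM2l ?(ltW (vol_gt0 K)).
have e0 K : e K = 0.
  have vol_e_ge0 (K' : elt M) : 0 <= simplex_vol (evert K') * e K'.
    by rewrite mulr_ge0 ?(ltW (vol_gt0 K')).
  have : \sum_(K : elt M) simplex_vol (evert K) * e K == 0.
    by rewrite eq_le sum_e sumr_ge0.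
  rewrite psumr_eq0 // => /allP /(_ K (mem_index_enum _)).
  by rewrite mulf_eq0 gt_eqF //= => /eqP.
have V_const (K : elt M) i i' : V (loc K i) = V (loc K i').
  have [C C0 hC] := hmesh K.
  have grad0 := energy_eq0 (nondeg K) (hF K) C0 hC (e0 K).
  have vK l : cell K (vert (loc K l)) := vert_in_simplex (nondeg K) l.
  apply/eqP; rewrite -subr_eq0 -!(fe_vert hphi).
  rewrite (fe_on_cell hM hphi V (vK i)) (fe_on_cell hM hphi V (vK i')).
  rewrite -dot_sum_qvec -(grad_fe hM hphi) grad0.
  by rewrite dotC -(scale0r 0) dotZr mul0r.
have [d0 _] := andP hd.
have [j0 /V_boundary Vj0] := exists_boundary_vertex hOmega hM d0.
have V0 := locally_constant_eq0 hOmega hM hphi V_const Vj0.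
have U_le (j : 'I_(nv M)) : U j <= c.
  by rewrite -subr_le0; apply/max_idPr; exact: V0.
apply: ge_sup.
  have [x xO] := domain_nonempty hOmega.
  by exists (u x), x => //; left.
move=> _ [x xcl <-]; apply: (fe_le hM hphi U_le).
by case: xcl => [/subset_closure|[]].
Qed.
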